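(* For every $n\in\mathbb N$ we have (i) $\displaystyle\sum_{k=0}^{[n/2]}\binom n{2k}(2^{n-2k}-1)U_{2k}=1-U_n$; (ii) $\displaystyle\sum_{k=0}^{[(n-1)/2]}\binom n{2k}6^{n-2k}U_{2k}=5^n+4^n-2^n-1$; (iii) $\displaystyle U_{2n}=1+2^{2n}-\sum_{k=0}^n\binom{2n}{2k}3^{2n-2k}U_{2k}$; (iv) $\displaystyle U_{2n}=2(-1)^n-4\sum_{k=1}^{[n/2]}\binom{2n}{4k}\left((-4)^k-1\right)U_{2n-4k}$; (v) $\displaystyle U_{2n}=4^{n-1}+\frac{1+V_{2n}}4-\frac34\sum_{k=1}^{[n/3]}\binom{2n}{6k}3^{6k}U_{2n-6k}$, where $\{V_m\}$ is given by $V_0=2$, $V_1=1$ and $V_{m+1}=V_m-7V_{m-1}$ for $m\ge1$.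
   Context: $\mathbb N$ is the set of positive integers; $[x]$ is the greatest integer not exceeding $x$. The sequence $\{U_n\}_{n\ge0}$ is defined by $U_0=1$ and $U_n=-2\sum_{k=1}^{[n/2]}\binom n{2k}U_{n-2k}$ for $n\ge1$. *)

(* Defs.v *)
From HB Require Import structures.
From mathcomp Require Import all_boot all_order all_algebra.

Set Implicit Arguments.
Unset Strict Implicit.
Unset Printing Implicit Defensive.

Import Order.TTheory GRing.Theory Num.Theory.
Local Open Scope ring_scope.

(* The recurrence for U_n is course-of-values, so the list [:: U_0; ...; U_n]
   is built; U_0 and U_rec below recover the defining equations. *)
Fixpoint U_seq (n : nat) : seq int :=
  if n is m.+1 then
    let s := U_seq m in
    rcons s (- 2 * \sum_(1 <= k < (n %/ 2).+1)
                      'C(n, 2 * k)%:Z * s`_(n - 2 * k))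
  else [:: 1].

Definition U (n : nat) : int := (U_seq n)`_n.

Fixpoint V (n : nat) : int :=
  match n with
  | 0 => 2
  | 1 => 1
  | (m.+1 as p).+1 => V p - 7 * V m
  end.

Lemma U_0 : U 0 = 1.
Proof. by []. Qed.

Lemma size_U_seq n : size (U_seq n) = n.+1.
Proof. by elim: n => //= n IH; rewrite size_rcons IH. Qed.

Lemma nth_U_seq n i : (i <= n)%N -> (U_seq n)`_i = U i.
Proof.
elim: n => [|n IH]; first by case: i.
rewrite leq_eqVlt => /orP[/eqP -> //|lt_in].
by rewrite /= nth_rcons size_U_seq lt_in IH.
Qed.

Lemma U_rec (n : nat) : (1 <= n)%N ->
  U n = - 2 * \sum_(1 <= k < (n %/ 2).+1) 'C(n, 2 * k)%:Z * U (n - 2 * k).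
Proof.
case: n => // n _.
rewrite {1}/U /= nth_rcons size_U_seq ltnn eqxx; congr (_ * _).
apply: eq_big_nat => k /andP[k_gt0 _]; rewrite nth_U_seq //.
by rewrite leq_subLR; case: k k_gt0 => // k _; rewrite mulnS -addnA add2n ltnW // !ltnS leq_addl.
Qed.

Lemma V_rec (m : nat) : (1 <= m)%N -> V m.+1 = V m - 7 * V m.-1.
Proof. by case: m. Qed.

(* Main.v *)
(* Let P_n(x) be the Appell polynomial sum_j C(n,j) U_(n-j) x^j.
   The recurrence for U says that the umbral functional L : X^n |-> U_n
   satisfies L(p(X+1)) + L(p(X-1)) - L(p) = p(0), hence
   P_n(x+1) + P_n(x-1) - P_n(x) = x^n, and so
   P_n(x+3) + P_n(x) = (x+1)^n + (x+2)^n.  Parts (i)-(iii) evaluate these at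
   x = 0, 1, 3.  Parts (iv) and (v) apply them at multiples of a primitive
   4th, resp. 6th, root of unity and use the roots-of-unity filter to extract
   the terms of P_(2n) whose degree is divisible by 4, resp. 6. *)
Require Import Defs.
From HB Require Import structures.
From mathcomp Require Import all_boot all_order all_algebra all_field.
From mathcomp Require Import ring zify.
Import Order.TTheory GRing.Theory Num.Theory.
Local Open Scope ring_scope.

(** * Sums supported on multiples of [d], and parity of [U] *)

Lemma sum_multiples {R : nmodType} (d n : nat) (F : nat -> R) :
  (0 < d)%N -> (forall j, ~~ (d %| j)%N -> F j = 0) ->
  \sum_(0 <= j < n.+1) F j = \sum_(0 <= k < (n %/ d).+1) F (d * k)%N.
Proof.
move=> d_gt0 F0; elim: n => [|n IH]; first by rewrite div0n !big_nat1 muln0.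
rewrite big_nat_recr //= IH divnS //.
have [dvd_n|ndvd_n] := boolP (d %| n.+1)%N; last by rewrite add0n F0 // addr0.
rewrite add1n [RHS]big_nat_recr //=; congr (_ + F _).
by rewrite -{1}(divnK dvd_n) divnS // dvd_n mulnC.
Qed.

Lemma U_odd n : odd n -> U n = 0.
Proof.
elim/ltn_ind: n => n IH odd_n; rewrite U_rec ?odd_gt0 // big_nat big1 ?mulr0 //.
move=> k /andP[k_gt0 _]; have [lt_n|le_kn] := ltnP n (2 * k).
  by rewrite bin_small ?mul0r.
by rewrite IH ?mulr0 //; lia.
Qed.

(** The factor 1 + (-1)^j kills odd j and doubles even j: the term j = 0 gives 2 U_n and the others
    add up to -U_n by the recurrence. The extra summand accounts for n = 0, where the sum is 2. *)
Lemma U_sum n :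
  \sum_(0 <= j < n.+1) 'C(n, j)%:Z * (1 + (-1) ^+ j) * U (n - j)
    = U n + (n == 0)%:R.
Proof.
rewrite (@sum_multiples _ 2) //; last first.
  by move=> j; rewrite dvdn2 negbK -signr_odd => ->; rewrite subrr mulr0 mul0r.
case: n => [|n]; first by rewrite big_nat1.
rewrite big_nat_recl // muln0 bin0 subn0 addr0.
have := @U_rec n.+1 isT; rewrite big_add1 /= => U_recn.
under eq_bigr => k _ do rewrite exprM sqrrN !expr1n -mulrA mulrCA.
by rewrite -mulr_sumr expr0 mul1r {}U_recn; ring.
Qed.

(** * Appell polynomials of [U] and their functional equations *)

Section Appell.

Variable R : comNzRingType.
Implicit Types (c x : R) (p q : {poly R}).

(** The ring is left arbitrary: (i)-(iii) evaluate over [int], (iv) and (v) over [algC]. *)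
Definition Upoly n x : R :=
  \sum_(0 <= j < n.+1) 'C(n, j)%:R * x ^+ (n - j) * (U j)%:~R.

Lemma Upoly_rev n x :
  Upoly n x = \sum_(0 <= j < n.+1) 'C(n, j)%:R * x ^+ j * (U (n - j))%:~R.
Proof.
rewrite /Upoly big_nat_rev /= add0n !big_nat; apply: eq_bigr => j /andP[_ lt_jn].
by rewrite subSS bin_sub // subKn.
Qed.

Lemma Upoly_even n x :
  Upoly n x = \sum_(0 <= k < (n %/ 2).+1)
                 'C(n, 2 * k)%:R * x ^+ (n - 2 * k) * (U (2 * k))%:~R.
Proof.
rewrite /Upoly (@sum_multiples _ 2) // => j; rewrite dvdn2 negbK => odd_j.
by rewrite U_odd // mulr0.
Qed.

Lemma Upoly0 n : Upoly n 0 = (U n)%:~R.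
Proof.
rewrite Upoly_rev big_nat_recl // big_nat big1 ?addr0 => [|j _].
  by rewrite bin0 subn0 !mul1r.
by rewrite expr0n mulr0 mul0r.
Qed.

(** Since odd-index [U] vanish, only powers of x with the parity of n occur. *)
Lemma UpolyN n x : Upoly n (- x) = (-1) ^+ n * Upoly n x.
Proof.
rewrite !Upoly_even mulr_sumr !big_nat; apply: eq_bigr => k /andP[_ le_k].
have {3}-> : n = (n - 2 * k + 2 * k)%N by lia.
by rewrite [(- x) ^+ _]exprNn exprD exprM sqrrN !expr1n; ring.
Qed.

Definition umbral p : R := \sum_(i < size p) p`_i * (U i)%:~R.

Lemma umbral_widen p m :
  (size p <= m)%N -> umbral p = \sum_(i < m) p`_i * (U i)%:~R.
Proof.
move=> le_pm; rewrite /umbral (big_ord_widen _ (fun i => p`_i * (U i)%:~R) le_pm).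
rewrite big_mkcond; apply: eq_bigr => i _.
by case: ltnP => // le_pi; rewrite nth_default ?mul0r.
Qed.

Lemma umbral_is_linear : linear_for *%R umbral.
Proof.
move=> a p q; set m := maxn (size (a *: p + q)) (maxn (size p) (size q)).
rewrite !(@umbral_widen _ m) ?leq_max ?leqnn ?orbT // mulr_sumr -big_split /=.
by apply: eq_bigr => i _; rewrite coefD coefZ mulrDl mulrA.
Qed.

HB.instance Definition _ :=
  GRing.isLinear.Build R {poly R} R *%R umbral umbral_is_linear.

Lemma umbralXn n : umbral 'X^n = (U n)%:~R.
Proof.
rewrite /umbral size_polyXn big_ord_recr /= big1 ?add0r ?coefXn ?eqxx ?mul1r //.
by move=> i _; rewrite coefXn ltn_eqF ?mul0r.
Qed.

Lemma umbral_shift n c : umbral (('X + c%:P) ^+ n) = Upoly n c.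
Proof.
rewrite addrC exprDn linear_sum /= /Upoly big_mkord; apply: eq_bigr => i _.
by rewrite -mulr_natl -polyC_exp -mulrA mulrCA mul_polyC -polyC_natr -mul_polyC
  mulrCA !mul_polyC !linearZ /= umbralXn mulrA.
Qed.

Lemma Upoly_pm1 n : Upoly n 1 + Upoly n (-1) = (U n)%:~R + (n == 0)%:R.
Proof.
have -> : (n == 0)%:R = ((n == 0)%:R : int)%:~R :> R by case: eqP.
rewrite -rmorphD -U_sum rmorph_sum !Upoly_rev -big_split /=.
apply: eq_bigr => j _.
by rewrite !rmorphM rmorphD rmorphXn rmorphN1 rmorph1 expr1n /= -!mulrDl -mulrDr.
Qed.

(** By linearity it suffices to treat monomials, where this is [Upoly_pm1]. *)
Lemma umbral_pm1 p :
  umbral (p \Po ('X + 1%:P)) + umbral (p \Po ('X + (-1)%:P))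
    = umbral p + p.[0].
Proof.
rewrite !comp_polyE !linear_sum /= horner_coef -!big_split /=.
apply: eq_bigr => i _.
by rewrite !linearZ /= !umbral_shift -mulrDr Upoly_pm1 mulrDr expr0n.
Qed.

Lemma Upoly_3term n x : Upoly n (x + 1) + Upoly n (x - 1) = Upoly n x + x ^+ n.
Proof.
have := umbral_pm1 (('X + x%:P) ^+ n).
rewrite !rmorphXn /= !comp_polyD !comp_polyX !comp_polyC -!addrA -!polyCD.
by rewrite !umbral_shift horner_exp hornerD hornerX hornerC add0r ![_ + x]addrC.
Qed.

(** Add the three-term relations at x + 1 and x + 2; the values at these two points cancel. *)
Lemma Upoly_add3 n x : Upoly n (x + 3) + Upoly n x = (x + 1) ^+ n + (x + 2) ^+ n.
Proof.
have := Upoly_3term n (x + 1); have := Upoly_3term n (x + 2).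
have -> : x + 2 + 1 = x + 3 by ring.
have -> : x + 2 - 1 = x + 1 by ring.
have -> : x + 1 + 1 = x + 2 by ring.
have -> : x + 1 - 1 = x by ring.
move=> eq2 eq1; apply: (addrI (Upoly n (x + 1) + Upoly n (x + 2))).
transitivity ((Upoly n (x + 3) + Upoly n (x + 1)) + (Upoly n (x + 2) + Upoly n x)).
  by ring.
by rewrite eq2 eq1; ring.
Qed.

End Appell.

(** * The roots-of-unity filter *)

Lemma sum_prim_root_exp {R : idomainType} {d} {z : R} j :
  d.-primitive_root z -> \sum_(s < d) (z ^+ s) ^+ j = (d %| j)%:R * d%:R.
Proof.
move=> prim_z; under eq_bigr => s _ do rewrite exprAC.
have [/dvdnP[q ->]|ndvd_j] := boolP (d %| j)%N.
  under eq_bigr => s _ do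
    rewrite mulnC exprM (prim_expr_order prim_z) !expr1n.
  by rewrite sumr_const card_ord mul1r.
(* Multiplied by the regular element z^j - 1, the geometric sum telescopes to z^(jd) - 1 = 0. *)
apply/eqP; rewrite mul0r -(mulrI_eq0 _ (_ : GRing.lreg (z ^+ j - 1))).
  by rewrite -subrX1 exprAC (prim_expr_order prim_z) expr1n subrr.
by apply/lregP; rewrite subr_eq0 -(prim_order_dvd prim_z).
Qed.

Lemma Upoly_filter {R : idomainType} {d} {z : R} n x :
  d.-primitive_root z ->
  \sum_(s < d) Upoly R n (z ^+ s * x)
    = d%:R * \sum_(0 <= k < (n %/ d).+1)
               'C(n, d * k)%:R * x ^+ (d * k) * (U (n - d * k))%:~R.
Proof.
move=> prim_z; under eq_bigr => s _ do rewrite Upoly_rev.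
rewrite exchange_big /=.
under eq_bigr => j _.
  under eq_bigr => s _ do rewrite exprMn mulrCA -mulrA.
  rewrite -mulr_suml (sum_prim_root_exp _ prim_z); over.
rewrite (@sum_multiples _ d) ?(prim_order_gt0 prim_z) //; last first.
  by move=> j /negPf->; rewrite !mul0r.
by rewrite mulr_sumr; apply: eq_bigr => k _; rewrite dvdn_mulr // mul1r.
Qed.

(** * Roots of unity of order 4 and 6, and the sequence [V] *)

Lemma prim4_root_sqr {R : idomainType} {z : R} : 4.-primitive_root z -> z ^+ 2 = -1.
Proof.
move=> prim_z; have := prim_expr_order prim_z.
rewrite -[4%N]/(2 * 2)%N exprM => /eqP; rewrite sqrf_eq1.
by rewrite -(prim_order_dvd prim_z) /= => /eqP.
Qed.

(** Here z^3 = -1 and z is not -1, so the factor z + 1 of z^3 + 1 can be cancelled. *)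
Lemma prim6_root_sqr {R : idomainType} {z : R} :
  6.-primitive_root z -> z ^+ 2 = z - 1.
Proof.
move=> prim_z; have := prim_expr_order prim_z.
rewrite -[6%N]/(3 * 2)%N exprM => /eqP; rewrite sqrf_eq1.
rewrite -(prim_order_dvd prim_z) /= => /eqP z3.
have /eqP : (z + 1) * (z ^+ 2 - (z - 1)) = 0.
  by transitivity (z ^+ 3 + 1); [ring | rewrite z3 addNr].
rewrite mulf_eq0 subr_eq0 addr_eq0 => /orP[/eqP z1|/eqP //].
by have := prim_order_dvd prim_z 2; rewrite z1 sqrrN expr1n eqxx.
Qed.

(** The elements a and 1 - a are roots of t^2 - t + 7, the characteristic polynomial of [V], and the
    initial values 2 and 1 are their power sums. *)
Lemma V_pow {R : comNzRingType} (a : R) n :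
  a ^+ 2 = a - 7 -> (V n)%:~R = a ^+ n + (1 - a) ^+ n.
Proof.
move=> a2; have rec m (b : R) : b ^+ 2 = b - 7 -> b ^+ m.+2 = b ^+ m.+1 - 7 * b ^+ m.
  by move=> b2; rewrite -addn2 exprD b2 exprS; ring.
have b2 : (1 - a) ^+ 2 = (1 - a) - 7 by rewrite sqrrB a2; ring.
suff [//] : (V n)%:~R = a ^+ n + (1 - a) ^+ n
   /\ (V n.+1)%:~R = a ^+ n.+1 + (1 - a) ^+ n.+1.
elim: n => [|n [IH0 IH1]]; first by split; rewrite /=; ring.
split=> //; rewrite V_rec // rmorphB rmorphM /= IH0 IH1 (rec n a a2) (rec n _ b2); ring.
Qed.

Lemma double_Upoly1 {R : comNzRingType} n : (0 < n)%N ->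
  2 * Upoly R (2 * n) 1 = (U (2 * n))%:~R.
Proof.
move=> n_gt0; have := Upoly_pm1 R (2 * n).
rewrite UpolyN exprM sqrrN !expr1n mul1r muln_eq0 /= (gtn_eqF n_gt0) addr0 => <-.
by ring.
Qed.

Lemma Upoly_double_opp {R : comNzRingType} n x :
  Upoly R (2 * n) (- x) = Upoly R (2 * n) x.
Proof. by rewrite UpolyN exprM sqrrN !expr1n mul1r. Qed.

(** Filter at 1 and at z + 1, where z^2 = -1. The three-term relation at z links the two results,
    P(z) is eliminated, and the remaining P(1) is half of U_(2n). *)
Lemma U2n_filter4 n : (0 < n)%N ->
  U (2 * n)
    = 2 * (- 1) ^+ n
      - 4 * \sum_(1 <= k < (n %/ 2).+1)
               'C(2 * n, 4 * k)%:Z * ((- 4) ^+ k - 1) * U (2 * n - 4 * k).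
Proof.
move=> n_gt0; have [z prim_z] := C_prim_root_exists (isT : 0 < 4)%N.
have z2 := prim4_root_sqr prim_z.
pose S (x : algC) := \sum_(0 <= k < (n %/ 2).+1)
  'C(2 * n, 4 * k)%:R * (x ^+ 4) ^+ k * (U (2 * n - 4 * k))%:~R.
(* The four points z^s x are x, zx and their opposites, and P_(2n) is even. *)
have filter x :
    Upoly algC (2 * n) x + Upoly algC (2 * n) (z * x) = 2 * S x.
  apply: (@mulfI _ 2); first by rewrite pnatr_eq0.
  have := Upoly_filter (2 * n) x prim_z.
  rewrite -[4%N]/(2 * 2)%N divnMl // !big_ord_recl big_ord0 /= /bump /=.
  rewrite expr0 mul1r expr1 z2 exprS z2 mulrN1 !mulNr !Upoly_double_opp mul1r.
  under eq_bigr => k _ do rewrite exprM.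
  by rewrite mulrA -natrM => <-; ring.
have filter1 := filter 1; have filter2 := filter (z + 1).
have P3 := Upoly_3term algC (2 * n) z; rewrite exprM z2 in P3.
have Phalf := @double_Upoly1 algC n n_gt0.
rewrite mulr1 in filter1.
(* Since z (z + 1) = z - 1, the filter at z + 1 involves exactly the neighbours of z. *)
rewrite mulrDr mulr1 -expr2 z2 [-1 + z]addrC P3 in filter2.
apply: (@intr_inj algC); rewrite rmorphB !rmorphM /= rmorphXn rmorphN1.
suff -> : (\sum_(1 <= k < (n %/ 2).+1)
    'C(2 * n, 4 * k)%:Z * ((- 4) ^+ k - 1) * U (2 * n - 4 * k))%:~R
    = S (z + 1) - S 1.
  transitivity (2 * (-1) ^+ n - (2 * (2 * S (z + 1)) - 2 * (2 * S 1)) : algC);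
    last by ring.
  by rewrite -filter1 -filter2 -Phalf; ring.
have z4 : (z + 1) ^+ 4 = -4.
  by transitivity ((z ^+ 2 + 2 * z + 1) ^+ 2); [ring | rewrite z2; ring: z2].
(* The terms k = 0 of the two sums cancel. *)
rewrite /S -sumrB z4 expr1n [RHS]big_nat_recl // !expr0 subrr add0r.
rewrite big_add1 /= rmorph_sum.
apply: eq_bigr => k _.
by rewrite !rmorphM rmorphB rmorphXn /= rmorphN expr1n; ring.
Qed.

(** Filter at 3. The term k = 0 gives 3 U_(2n), and P(3) = 1 + 4^n - U_(2n) supplies the fourth
    copy; the factor 4 keeps the identity integral. *)
Lemma U2n_filter6 n : (0 < n)%N ->
  4 * U (2 * n)
    = 4 ^+ n + 1 + V (2 * n)
      - 3 * \sum_(1 <= k < (n %/ 3).+1)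
               'C(2 * n, 6 * k)%:Z * 3 ^+ (6 * k) * U (2 * n - 6 * k).
Proof.
move=> n_gt0; have [z prim_z] := C_prim_root_exists (isT : 0 < 6)%N.
have z2 := prim6_root_sqr prim_z.
have z3 : z ^+ 3 = -1 by rewrite exprS z2 mulrBr -expr2 z2; ring.
pose P := Upoly algC (2 * n).
(* As z^2 = z - 1 and z^3 = -1, the six points are 3, 3z, 3z - 3 and their opposites. *)
have filter : P 3 + P (z * 3) + P (z * 3 - 3) =
    3 * \sum_(0 <= k < (n %/ 3).+1)
          'C(2 * n, 6 * k)%:R * 3 ^+ (6 * k) * (U (2 * n - 6 * k))%:~R.
  apply: (@mulfI _ 2); first by rewrite pnatr_eq0.
  have := Upoly_filter (2 * n) 3 prim_z.
  have -> : (2 * n %/ 6 = n %/ 3)%N by lia.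
  rewrite !big_ord_recl big_ord0 /= /bump /=.
  rewrite -[(1 + (1 + (1 + (1 + (1 + 0)))))%N]/(3 + 2)%N.
  rewrite -[(1 + (1 + (1 + (1 + 0))))%N]/(3 + 1)%N -[(1 + (1 + (1 + 0)))%N]/3%N.
  rewrite -[(1 + (1 + 0))%N]/2%N !exprD z3 expr0 !expr1 mulr1 z2.
  rewrite !mulN1r !mulNr !Upoly_double_opp mulrBl mul1r.
  by rewrite mulrA -natrM => <-; rewrite /P; ring.
have P30 := Upoly_add3 algC (2 * n) 0.
rewrite !add0r expr1n Upoly0 exprM -natrX -/P in P30.
(* The points 3z - 3 and 3z differ by 3, so [Upoly_add3] applies. With a = 3z - 1 one has a^2 = a -
   7, and 3z - 2 is the opposite of 1 - a, raised to an even power. *)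
have P3z : P (z * 3) + P (z * 3 - 3) = (V (2 * n))%:~R.
  have := Upoly_add3 algC (2 * n) (z * 3 - 3); rewrite subrK => ->.
  rewrite (@V_pow _ (z * 3 - 1)); last by rewrite sqrrB exprMn z2; ring.
  have -> : 1 - (z * 3 - 1) = - (z * 3 - 3 + 1) by ring.
  by rewrite [in RHS]exprM [in X in _ = _ + X]exprM sqrrN -!exprM addrC;
    congr (_ ^+ _ + _); ring.
apply: (@intr_inj algC); rewrite rmorphB !rmorphM !rmorphD /= rmorphXn -P3z.
rewrite rmorph_sum; under eq_bigr => k _ do rewrite !rmorphM /= rmorphXn.
rewrite big_ltn // muln0 bin0 subn0 expr0 !mul1r in filter; move: filter.
set T := \sum_(1 <= k < _) _ => filter.
transitivity (P 3 + (U (2 * n))%:~R + P (z * 3) + P (z * 3 - 3) - 3 * T).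
  transitivity ((U (2 * n))%:~R + 3 * ((U (2 * n))%:~R + T) - 3 * T); first by ring.
  by rewrite -filter; ring.
by rewrite P30; ring.
Qed.

Theorem theorem2p4 (n : nat) (hn : (1 <= n)%N) :
  [/\ \sum_(0 <= k < (n %/ 2).+1)
         'C(n, 2 * k)%:Z * (2 ^+ (n - 2 * k) - 1) * U (2 * k)
       = 1 - U n,
      \sum_(0 <= k < ((n - 1) %/ 2).+1)
         'C(n, 2 * k)%:Z * 6 ^+ (n - 2 * k) * U (2 * k)
       = 5 ^+ n + 4 ^+ n - 2 ^+ n - 1,
      U (2 * n)
       = 1 + 2 ^+ (2 * n)
         - \sum_(0 <= k < n.+1)
              'C(2 * n, 2 * k)%:Z * 3 ^+ (2 * n - 2 * k) * U (2 * k),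
      U (2 * n)
       = 2 * (- 1) ^+ n
         - 4 * \sum_(1 <= k < (n %/ 2).+1)
                  'C(2 * n, 4 * k)%:Z * ((- 4) ^+ k - 1) * U (2 * n - 4 * k)
    & (U (2 * n))%:Q
       = 4 ^+ (n - 1) + (1 + (V (2 * n))%:Q) / 4
         - 3 / 4 * \sum_(1 <= k < (n %/ 3).+1)
                      'C(2 * n, 6 * k)%:Q * 3 ^+ (6 * k)
                      * (U (2 * n - 6 * k))%:Q ].
Proof.
have P_int m x : Upoly int m x = \sum_(0 <= k < (m %/ 2).+1)
    'C(m, 2 * k)%:Z * x ^+ (m - 2 * k) * U (2 * k).
  by rewrite Upoly_even; apply: eq_bigr => k _; rewrite intz natz.
have P0 m : Upoly int m 0 = U m by rewrite Upoly0 intz.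
have P3 : Upoly int n 3 + U n = 1 + 2 ^+ n.
  by rewrite -P0 -[3]add0r Upoly_add3 !add0r expr1n.
split.
(* (i): the three-term relation at 1. *)
- have P21 : Upoly int n 2 - Upoly int n 1 = 1 - U n.
    have := Upoly_3term int n 1; rewrite subrr expr1n P0 => eq_P.
    by apply: (addIr (U n + Upoly int n 1)); rewrite [RHS]addrA subrK addrC -eq_P; ring.
  rewrite -P21 !P_int -sumrB; apply: eq_bigr => k _.
  by rewrite expr1n mulrBr mulrBl.
(* (ii): subtract the step-3 relation at 0 from the one at 3. *)
- have P6 : Upoly int n 6 - U n = 5 ^+ n + 4 ^+ n - 2 ^+ n - 1.
    have := Upoly_add3 int n 3; have -> : 3 + 3 = 6 :> int by [].
    have -> : 3 + 1 = 4 :> int by [].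
    have -> : 3 + 2 = 5 :> int by [].
    move=> P63; transitivity ((Upoly int n 6 + Upoly int n 3) - (Upoly int n 3 + U n)).
      by ring.
    by rewrite P63 P3; ring.
  (* For odd n both sums have the same range and U_n = 0; for even n the full sum has one more term,
     equal to U_n. *)
  rewrite -P6 P_int; case: (boolP (odd n)) => [odd_n|even_n].
    by rewrite U_odd // subr0; congr (\sum_(0 <= k < _.+1) _); lia.
  have -> : (n %/ 2 = ((n - 1) %/ 2).+1)%N by lia.
  rewrite [in RHS]big_nat_recr //=; set m := (2 * _.+1)%N.
  have -> : m = n by lia.
  by rewrite binn subnn expr0 mulr1 mul1r addrK.
(* (iii): the step-3 relation at 0, with index 2n. *)
- have := Upoly_add3 int (2 * n) 0; rewrite !add0r expr1n P0 P_int mulKn // => <-.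
  by rewrite addrC addKr.
- exact: U2n_filter4.
have U4 := congr1 (fun x : int => x%:~R : rat) (U2n_filter6 _ hn).
(* (v): clear the denominator 4 in the rationals. *)
set T := \sum_(1 <= k < _) _; apply: (@mulfI _ 4) => //.
have castT : (\sum_(1 <= k < (n %/ 3).+1)
    'C(2 * n, 6 * k)%:Z * 3 ^+ (6 * k) * U (2 * n - 6 * k))%:~R = T.
  by rewrite rmorph_sum; apply: eq_bigr => k _; rewrite !rmorphM /= rmorphXn.
move: U4; rewrite rmorphB !rmorphM !rmorphD /= castT rmorphXn => ->.
have -> : 4%:~R ^+ n = 4 * 4 ^+ (n - 1) :> rat.
  by rewrite -exprS -subSn // subn1.
by field.
Qed.
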